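(* Let $T\in\mathcal C(H_1,H_2)$ attain its reduced minimum, i.e. suppose there exists $x_0\in C(T)$ with $\|x_0\|=1$ and $\|Tx_0\|=\gamma(T)$. Then the range $R(T)$ is closed.
   Context: $H_1,H_2$ are infinite dimensional complex Hilbert spaces. $\mathcal C(H_1,H_2)$ denotes the class of densely defined closed linear operators from a dense subspace $D(T)\subseteq H_1$ into $H_2$. $N(T)$ is the null space of $T$, $C(T):=D(T)\cap N(T)^{\perp}$ is its carrier, and $\gamma(T):=\inf\{\|Tx\|: x\in C(T),\ \|x\|=1\}$ is its reduced minimum modulus. *)

(* Defs.v *)
From HB Require Import structures.
From mathcomp Require Import all_boot all_order all_algebra.
From mathcomp Require Import complex.
From mathcomp Require Import all_classical all_reals all_analysis.

Set Implicit Arguments.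
Unset Strict Implicit.
Unset Printing Implicit Defensive.

Import Order.TTheory GRing.Theory Num.Theory.
Import numFieldNormedType.Exports.

Local Open Scope classical_set_scope.
Local Open Scope ring_scope.
Local Open Scope complex_scope.

(* A complex Hilbert space is a complete normed space over R[i] whose norm is
   induced by an inner product, linear on the left and conjugate-linear on the
   right. *)
HB.mixin Record CompleteNormedModule_isHilbert (R : realType) H
    of CompleteNormedModule R[i] H := {
  inner : {dot H for (@Num.conj R[i])} ;
  sqr_norm_inner : forall x : H, `|x| ^+ 2 = inner x x
}.

#[short(type="hilbertType")]
HB.structure Definition Hilbert (R : realType) :=
  { H of CompleteNormedModule R[i] H & CompleteNormedModule_isHilbert R H }.

Section HilbertSpace.
Context {R : realType} {H : hilbertType R}.

(* The library norm `|x| lies in R[i]; it is a nonnegative real there. *)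
Definition hnorm (x : H) : R := complex.Re `|x|.

Definition orthogonal_complement (A : set H) : set H :=
  [set x | forall y, A y -> inner x y = 0].

Definition linear_subspace (A : set H) : Prop :=
  A 0 /\ forall (a : R[i]) x y, A x -> A y -> A (a *: x + y).

End HilbertSpace.

Definition infinite_dimensional (R : realType) (H : hilbertType R) : Prop :=
  ~ exists (n : nat) (v : 'I_n -> H),
      forall x : H, exists c : 'I_n -> R[i], x = \sum_(i < n) c i *: v i.

(* Only the values of [op_fun] on [dom] are meaningful: every notion below
   restricts to [dom]. *)
Record closed_operator (R : realType) (H1 H2 : hilbertType R) :=
  ClosedOperator {
    op_fun :> H1 -> H2 ;
    dom : set H1 ;
    dom_subspace : linear_subspace dom ;
    dom_dense : dense dom ;
    op_linear : forall (a : R[i]) x y, dom x -> dom y ->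
      op_fun (a *: x + y) = a *: op_fun x + op_fun y ;
    graph_closed : closed [set (x, op_fun x) | x in dom]
  }.

Section ClosedOperator.
Context {R : realType} {H1 H2 : hilbertType R}.
Implicit Type T : closed_operator H1 H2.

Definition null_space T : set H1 := [set x | dom T x /\ T x = 0].

Definition op_range T : set H2 := T @` dom T.

Definition carrier T : set H1 :=
  dom T `&` orthogonal_complement (null_space T).

(* Extended-real infimum, so that the value is +oo when the carrier is {0}. *)
Definition reduced_min_modulus T : \bar R :=
  ereal_inf [set (hnorm (T x))%:E | x in [set x | carrier T x /\ hnorm x = 1]].

Definition attains_reduced_min T : Prop :=
  exists x0, [/\ carrier T x0, hnorm x0 = 1 &
    (hnorm (T x0))%:E = reduced_min_modulus T].

End ClosedOperator.

(* Main.v *)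
(* If the minimum gamma were 0, its minimiser would lie both in N(T) and in
   its orthogonal complement, hence be 0; so gamma > 0.  By homogeneity
   gamma |x| <= |T x| on the carrier.  Projecting onto the closed subspace N(T)
   shows that T maps its carrier onto R(T), so a point y of the closure of R(T)
   is a limit of T u_n with u_n in the carrier.  The lower bound makes u_n
   Cauchy, and its limit l satisfies T l = y because the graph is closed. *)

Require Import Defs.
From mathcomp Require Import all_boot all_order all_algebra.
From mathcomp Require Import complex.
From mathcomp Require Import all_classical all_reals all_analysis.
From mathcomp Require Import ring lra.

Import Order.TTheory GRing.Theory Num.Theory.
Import numFieldNormedType.Exports.
Local Open Scope classical_set_scope.
Local Open Scope ring_scope.
Local Open Scope complex_scope.

(** * The real-valued norm: identities, limits and completeness *)

Section HilbertNorm.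
Context {R : realType} {H : hilbertType R}.
Implicit Types (x y : H) (A : set H).

Lemma hnormE x : `|x| = (hnorm x)%:C.
Proof. by rewrite /hnorm RRe_real// normr_real. Qed.

Lemma hnorm_ge0 x : 0 <= hnorm x.
Proof. by rewrite -lecR -hnormE; exact: normr_ge0. Qed.

Lemma hnorm0_eq0 x : hnorm x = 0 -> x = 0.
Proof. by move=> x0; apply/eqP; rewrite -normr_eq0 hnormE x0. Qed.

Lemma ler_hnormD x y : hnorm (x + y) <= hnorm x + hnorm y.
Proof. by rewrite -lecR rmorphD/= -!hnormE ler_normD. Qed.

Lemma hnormZ (c : R) x : hnorm (c%:C *: x) = `|c| * hnorm x.
Proof.
apply: (@complexI R); rewrite rmorphM/= -!hnormE normrZ; congr (_ * _).
by rewrite normc_def/= expr0n/= addr0 sqrtr_sqr.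
Qed.

Lemma hdistrC x y : hnorm (x - y) = hnorm (y - x).
Proof. by rewrite /hnorm distrC. Qed.

Lemma hnorm_parallelogram x y :
  hnorm (x + y) ^+ 2 + hnorm (x - y) ^+ 2 = 2 * hnorm x ^+ 2 + 2 * hnorm y ^+ 2.
Proof.
apply: (@complexI R).
rewrite !rmorphD/= !mulr_natl !rmorphMn/= !rmorphXn/= -!hnormE !sqr_norm_inner dnormD dnormB.
ring.
Qed.

Lemma cvg_hnormP (u : nat -> H) (l : H) :
  u @ \oo --> l <-> forall e : R, 0 < e -> \forall n \near \oo, hnorm (l - u n) < e.
Proof.
split=> [/cvgrPdist_lt ul e e0|ul].
  have : 0 < e%:C by rewrite ltcR.
  by move=> /ul; apply: filterS => n; rewrite hnormE ltcR.
apply/cvgrPdist_lt => e e0.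
(* A positive element of [R[i]] is real, so the complex tolerance [e] reduces to a real one. *)
have eE : e = (complex.Re e)%:C by rewrite RRe_real// gtr0_real.
move: e0; rewrite eE ltcR => /ul.
by apply: filterS => n; rewrite hnormE ltcR.
Qed.

Lemma hnorm_cauchy_cvg (u : nat -> H) :
  (forall e : R, 0 < e ->
    exists N, forall m n, (N <= m)%N -> (N <= n)%N -> hnorm (u m - u n) < e) ->
  exists l : H, u @ \oo --> l.
Proof.
move=> uC; apply/cvg_ex/cauchy_cvgP/cauchy_exP => e e0.
have eE : e = (complex.Re e)%:C by rewrite RRe_real// gtr0_real.
move: e0; rewrite eE ltcR => /uC[N uN].
exists (u N); exists N => // n /= Nn.
by rewrite -ball_normE/= hnormE ltcR uN.
Qed.

Lemma closure_hnormP A x :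
  closure A x -> forall e : R, 0 < e -> exists2 a, A a & hnorm (x - a) < e.
Proof.
move=> + e e0 => /(_ (ball x e%:C)).
have : nbhs x (ball x e%:C) by apply: nbhsx_ballx; rewrite ltcR.
move=> /[swap] /[apply] -[a [Aa]].
by rewrite -ball_normE/= hnormE ltcR; exists a.
Qed.

(** * Subspaces, orthogonality and projection *)

Lemma linear_subspaceZ A a x : linear_subspace A -> A x -> A (a *: x).
Proof. by move=> [A0 AL] Ax; rewrite -[_ *: _]addr0; exact: AL. Qed.

Lemma linear_subspaceB A x y : linear_subspace A -> A x -> A y -> A (x - y).
Proof. by move=> [_ AL] Ax Ay; rewrite addrC -scaleN1r; exact: AL. Qed.

Lemma linear_subspace_orthogonal_complement A :
  linear_subspace (orthogonal_complement A).
Proof.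
split=> [y _|a x y xA yA z Az]; first by rewrite linear0l.
by rewrite linearPl/= xA// yA// addr0 mulr0.
Qed.

(** Removing from [x] its component [c *: y] along [y] leaves [z] orthogonal to [y]. By Pythagoras
    the squared norm drops by that of [c *: y], so minimality forces [c = 0]. *)
Lemma inner_eq0_minimal x y :
  (forall c : R[i], hnorm x <= hnorm (x - c *: y)) -> inner x y = 0.
Proof.
move=> xmin; have [->|y0] := eqVneq y 0; first by rewrite linear0r.
pose c := inner x y / inner y y; pose z := x - c *: y.
have zy : inner z y = 0.
  by rewrite /z linearBl linearZl_LR/= divfK ?subrr// dnorm_eq0.
have xE : inner x x = inner z z + `|c| ^+ 2 * inner y y.
  rewrite -dnormZ -hnormDd; first by rewrite /z subrK.
  by rewrite linearZr_LR/= zy mulr0.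
have : inner x x <= inner z z.
  rewrite -!sqr_norm_inner !hnormE -!rmorphXn/= lecR.
  by rewrite lerXn2r ?nnegrE ?hnorm_ge0//; exact: xmin.
rewrite xE gerDl => cy.
have : `|c| ^+ 2 * inner y y == 0.
  by rewrite eq_le cy mulr_ge0 ?exprn_ge0 ?dnorm_ge0.
rewrite mulf_eq0 dnorm_eq0 (negPf y0) orbF expf_eq0/= normr_eq0 /c mulf_eq0.
by rewrite invr_eq0 dnorm_eq0 (negPf y0) orbF => /eqP.
Qed.

(** A sequence [a] in [A] whose distances to [x] tend to the infimum [d] is Cauchy. Its limit exists
    by completeness, lies in [A] by closedness, and realises [d]. *)
Lemma closest_point A x : linear_subspace A -> closed A ->
  exists2 a, A a & forall b, A b -> hnorm (x - a) <= hnorm (x - b).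
Proof.
move=> LA cA; pose D := [set hnorm (x - b) | b in A]; pose d := inf D.
have Dlb : has_lbound D by exists 0 => _ [b _ <-]; exact: hnorm_ge0.
have D0 : D !=set0 by exists (hnorm (x - 0)), 0 => //; case: LA.
have dD b : A b -> d <= hnorm (x - b) by move=> Ab; apply: ge_inf => //; exists b.
have d0 : 0 <= d by apply: lb_le_inf => // _ [b _ <-]; exact: hnorm_ge0.
have /choice[a aP] : forall n : nat, exists b, A b /\ hnorm (x - b) < d + n.+1%:R^-1.
  move=> n; have : 0 < n.+1%:R^-1 :> R by rewrite invr_gt0.
  by move=> /inf_adherent/(_ (conj D0 Dlb))[_ [b Ab <-] ?]; exists b.
(* The midpoint of [a m] and [a n] lies in [A], so the parallelogram identity
   makes [a m] and [a n] close as soon as both nearly minimise the distance. *)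
have aB m n (e : R) : 0 <= e -> hnorm (x - a m) <= d + e ->
    hnorm (x - a n) <= d + e -> hnorm (a m - a n) ^+ 2 <= 4 * (2 * d + e) * e.
  move=> e0 am an.
  have mid : d <= hnorm (x - 2^-1%:C *: (a m + a n)).
    apply: dD; apply: linear_subspaceZ => //.
    rewrite -[a m]scale1r; case: LA => _; apply; exact: (aP _).1.
  have := hnorm_parallelogram (x - a m) (x - a n).
  have -> : x - a m - (x - a n) = - (a m - a n).
    by rewrite opprB addrC opprB addrA subrK addrC.
  have -> : x - a m + (x - a n) = 2%:C *: (x - 2^-1%:C *: (a m + a n)).
    rewrite scalerBr scalerA -rmorphM/= divff ?pnatr_eq0// scale1r.
    by rewrite rmorph_nat scaler_nat mulr2n opprD addrACA.
  rewrite hnormZ ger0_norm// -[- (a m - a n)]scaleN1r.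
  have -> : -1 = (-1)%:C :> R[i] by rewrite rmorphN1.
  rewrite hnormZ normrN1 mul1r => E.
  (* The bound is [2(d+e)^2 + 2(d+e)^2 - 4d^2 = 4(2d+e)e], the subtracted term coming from [mid]. *)
  have := hnorm_ge0 (x - a m); have := hnorm_ge0 (x - a n); nra.
have small (e : R) : 0 < e -> \forall n \near \oo, hnorm (x - a n) <= d + e.
  move=> e0; have [N _ Ne] := near_infty_natSinv_lt (PosNum e0).
  exists N => // n /Ne/= ne; apply/ltW/(lt_trans (aP n).2).
  by rewrite ltrD2l.
have [l al] : exists l : H, a @ \oo --> l.
  apply: hnorm_cauchy_cvg => e e0.
  have k0 : 0 < 4 * (2 * d + 1) :> R by nra.
  (* With this [t], [4(2d+t)t <= 4(2d+1)t <= e^2/2 < e^2]: the first step uses [t <= 1], and the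
     factor 2 makes the last one strict. *)
  pose t := Num.min 1 (e ^+ 2 / (2 * (4 * (2 * d + 1)))).
  have t0 : 0 < t by rewrite lt_min ltr01/= divr_gt0 ?exprn_gt0// mulr_gt0.
  have t1 : t <= 1 by rewrite ge_min lexx.
  have te : t * (2 * (4 * (2 * d + 1))) <= e ^+ 2.
    by rewrite -ler_pdivlMr ?ge_min ?lexx ?orbT// mulr_gt0.
  have [N _ Nt] := small t t0.
  exists N => m n Nm Nn.
  have /= := aB m n t (ltW t0) (Nt m Nm) (Nt n Nn).
  have := hnorm_ge0 (a m - a n).
  have : 0 < e ^+ 2 by rewrite exprn_gt0.
  set h := hnorm _ => e2 h0 hle.
  rewrite -(@ltr_pXn2r _ 2)// ?nnegrE ?(ltW e0)//.
  nra.
exists l.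
  by apply: (closed_cvg _ cA _ _ al); apply: nearW => n; exact: (aP n).1.
move=> b Ab; apply: (le_trans _ (dD b Ab)); apply/ler_addgt0Pr => e e0.
have e20 : 0 < e / 2 by rewrite divr_gt0.
have /cvg_hnormP/(_ _ e20) la := al.
near \oo => n.
have -> : x - l = (x - a n) + (a n - l) by rewrite addrA subrK.
apply: (le_trans (ler_hnormD _ _)).
have : hnorm (x - a n) <= d + e / 2 by near: n; exact: small.
have : hnorm (l - a n) < e / 2 by near: n.
rewrite hdistrC; lra.
Unshelve. all: by end_near. Qed.

(** Take for [a] the point of [A] closest to [x]. For [y] in [A], [a + c *: y] is again in [A], so
    subtracting [c *: y] cannot shorten [x - a]. *)
Lemma orthogonal_projection A x : linear_subspace A -> closed A ->
  exists2 a, A a & orthogonal_complement A (x - a).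
Proof.
move=> LA cA; have [a Aa amin] := closest_point A x LA cA.
exists a => // y Ay; apply: inner_eq0_minimal => c.
rewrite -addrA -opprD; apply: amin.
by rewrite addrC; case: LA => _; apply.
Qed.

End HilbertNorm.

(** * Closed operators: null space, carrier and range *)

Section ClosedOperator.
Context {R : realType} {H1 H2 : hilbertType R}.
Variable T : closed_operator H1 H2.

Lemma op_fun0 : T 0 = 0.
Proof.
have T0 := (dom_subspace T).1.
have := op_linear 1 T0 T0.
by rewrite !scale1r addr0 -[LHS]addr0 => /addrI/esym.
Qed.

Lemma op_funZ a x : dom T x -> T (a *: x) = a *: T x.
Proof.
move=> Tx; rewrite -[a *: x]addr0 op_linear//; last exact: (dom_subspace T).1.
by rewrite op_fun0 addr0.
Qed.

Lemma op_funB x y : dom T x -> dom T y -> T (x - y) = T x - T y.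
Proof. by move=> Tx Ty; rewrite addrC -scaleN1r op_linear// scaleN1r addrC. Qed.

Lemma linear_subspace_null_space : linear_subspace (null_space T).
Proof.
have [T0 TL] := dom_subspace T.
split=> [|a x y [Tx Tx0] [Ty Ty0]]; first by split=> //; exact: op_fun0.
by split; [exact: TL|rewrite op_linear// Tx0 Ty0 scaler0 addr0].
Qed.

Lemma linear_subspace_carrier : linear_subspace (carrier T).
Proof.
have [T0 TL] := dom_subspace T.
have [N0 NL] := linear_subspace_orthogonal_complement (null_space T).
by split=> // a x y [Tx Nx] [Ty Ny]; split; [exact: TL|exact: NL].
Qed.

(** It is the preimage of the closed graph under the continuous map sending [x] to [(x, 0)]. *)
Lemma closed_null_space : closed (null_space T).
Proof.
have -> : null_space T =
    (fun x => (x, 0 : H2)) @^-1` [set (x, T x) | x in dom T].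
  apply/seteqP; split=> x /=; first by move=> [Tx Tx0]; exists x; rewrite ?Tx0.
  by move=> [y Ty [<- Ty0]].
apply: closed_comp (@graph_closed _ _ _ T) => x _.
by apply: cvg_pair; [exact: cvg_id|exact: cvg_cst].
Qed.

(** For [x] nonzero, the unit vector [x / hnorm x] stays in the carrier and competes in the
    infimum. *)
Lemma reduced_min_modulus_le g x :
  (g%:E = reduced_min_modulus T)%E -> carrier T x -> g * hnorm x <= hnorm (T x).
Proof.
move=> gE Cx; have [x0|x0] := eqVneq (hnorm x) 0.
  by rewrite x0 mulr0 hnorm_ge0.
have xgt0 : 0 < hnorm x by rewrite lt_def x0 hnorm_ge0.
have : (g%:E <= (hnorm (T ((hnorm x)^-1%:C *: x)))%:E)%E.
  rewrite gE; apply: ereal_inf_lbound => /=.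
  exists ((hnorm x)^-1%:C *: x) => //; split.
    by apply: linear_subspaceZ => //; exact: linear_subspace_carrier.
  by rewrite hnormZ gtr0_norm ?invr_gt0// mulVf.
rewrite lee_fin op_funZ; last by case: Cx.
by rewrite hnormZ gtr0_norm ?invr_gt0// ler_pdivlMl// mulrC.
Qed.

Lemma carrier_null_space x : carrier T x -> T x = 0 -> x = 0.
Proof.
move=> [Tx Nx] Tx0; apply/eqP; rewrite -(@dnorm_eq0 _ _ inner); apply/eqP.
exact: Nx.
Qed.

(** Subtract from [x] its projection onto [null_space T]; that projection is in the domain, so the
    difference is too. *)
Lemma op_range_carrier x : dom T x -> exists2 z, carrier T z & T z = T x.
Proof.
move=> Tx.
have [a [Ta Ta0] Na] := orthogonal_projection _ x linear_subspace_null_space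
  closed_null_space.
exists (x - a); last by rewrite op_funB// Ta0 subr0.
by split=> //; apply: linear_subspaceB => //; exact: dom_subspace.
Qed.

Lemma bounded_below_closed_range g : 0 < g ->
  (forall x, carrier T x -> g * hnorm x <= hnorm (T x)) -> closed (op_range T).
Proof.
move=> g0 gT y /closure_hnormP Ry.
have /choice[u uP] (n : nat) :
    exists x, carrier T x /\ hnorm (y - T x) < n.+1%:R^-1.
  have /Ry[_ [x /op_range_carrier[z Cz <-] <-] xy] : 0 < n.+1%:R^-1 :> R.
    by rewrite invr_gt0.
  by exists z.
have Tuy : (fun n => T (u n)) @ \oo --> y.
  apply/cvg_hnormP => e e0.
  have [N _ Ne] := near_infty_natSinv_lt (PosNum e0).
  by exists N => // n /Ne/=; apply: lt_trans (uP n).2.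
have [l ul] : exists l : H1, u @ \oo --> l.
  apply: hnorm_cauchy_cvg => e e0.
  (* Two errors below [g * e / 2] keep [T (u m)] and [T (u n)] within [g * e]; the lower bound then
     cancels [g]. *)
  have ge0 : 0 < g * e / 2 by rewrite divr_gt0// mulr_gt0.
  have /cvg_hnormP/(_ _ ge0)[N _ NT] := Tuy.
  exists N => m n Nm Nn; rewrite -(ltr_pM2l g0).
  have [[Cm _] [Cn _]] := (uP m, uP n).
  have Cmn := linear_subspaceB _ _ _ linear_subspace_carrier Cm Cn.
  apply: (le_lt_trans (gT _ Cmn)); rewrite (op_funB _ _ Cm.1 Cn.1).
  have -> : T (u m) - T (u n) = (T (u m) - y) + (y - T (u n)).
    by rewrite addrA subrK.
  apply: (le_lt_trans (ler_hnormD _ _)); rewrite hdistrC.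
  have /= := NT m Nm; have /= := NT n Nn; lra.
(* The graph contains every pair [(u n, T (u n))], hence also their limit. *)
have [x Tx [_ <-]] : [set (x, T x) | x in dom T] (l, y).
  have uTu : (fun n => (u n, T (u n))) @ \oo --> (l, y) by exact: cvg_pair.
  apply: (closed_cvg _ (@graph_closed _ _ _ T) _ _ uTu).
  by apply: nearW => n; exists (u n) => //; exact: (uP n).1.1.
by exists x.
Qed.

End ClosedOperator.

Theorem proposition3p5 (R : realType) (H1 H2 : hilbertType R)
    (H1_inf : infinite_dimensional H1) (H2_inf : infinite_dimensional H2)
    (T : closed_operator H1 H2) :
  attains_reduced_min T -> closed (op_range T).
Proof.
move=> [x0 [Cx0 x01 gE]].
apply: (@bounded_below_closed_range _ _ _ _ (hnorm (T x0))) => [|x]; last first.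
  exact: reduced_min_modulus_le.
(* Attainment gives positivity here: [T x0 = 0] would force the unit vector [x0] to vanish. *)
rewrite lt_def hnorm_ge0 andbT; apply/eqP => /hnorm0_eq0 Tx00.
move: x01; rewrite (carrier_null_space _ _ Cx0 Tx00) /hnorm normr0/= => /esym/eqP.
by rewrite oner_eq0.
Qed.
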